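(* Let $\mathcal{P}_0\subset\mathcal{P}$. Suppose that for each $P\in\mathcal{P}_0$ there exist deterministic rate functions $g_P,h_P$ tending to zero as $n\to\infty$ and functions $\xi,\xi':[0,1]\times[0,1]^d\to\mathbb{R}$ such that (i) $\|F_{X\mid Z}-\hat F^{(n)}_{X\mid Z}\|_{\mathcal{T},\infty}\in\mathcal{O}_P(g_P(n))$ and $\|F_{Y\mid Z}-\hat F^{(n)}_{Y\mid Z}\|'_{\mathcal{T},\infty}\in\mathcal{O}_P(h_P(n))$; (ii) $\|\xi-\hat F^{(n)}_{X\mid Z}\|_{\mathcal{T}^c,\infty}\in\mathcal{O}_P(g_P(n))$ and $\|\xi'-\hat F^{(n)}_{Y\mid Z}\|'_{\mathcal{T}^c,\infty}\in\mathcal{O}_P(h_P(n))$. Let $\mathcal{A}_0\subseteq\mathcal{P}_0\setminus\mathcal{H}$ be the subset of distributions for which $\rho_{k\ell}\ne0$ for at least one combination of $k,\ell=1,\dots,q$, where $\rho=E_P(\phi(U_1)\phi(U_2)^T)$. For $\alpha\in(0,1)$ let $\hat\Psi_n=1(T_n>n^{-1}z_{1-\alpha})$, where $z_{1-\alpha}$ is the $(1-\alpha)$-quantile of the $\chi^2_{q^2}$-distribution. Then for each level $\alpha\in(0,1)$ the test $\hat\Psi_n$ has asymptotic pointwise power against $\mathcal{A}_0$, i.e. $$\liminf_{n\to\infty}E_P(\hat\Psi_n)=1$$ for each fixed $P\in\mathcal{A}_0$.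
   Context: $\mathcal{P}$ is the set of distributions of $(X,Y,Z)$ on $[0,1]^{2+d}$ ($X,Y\in[0,1]$, $Z\in[0,1]^d$) absolutely continuous with respect to Lebesgue measure; $\mathcal{H}\subset\mathcal{P}$ is the subset for which $X$ and $Y$ are conditionally independent given $Z$. Throughout, for every $z$ the conditional distributions of $X$ and of $Y$ given $Z=z$ are continuous. $F_{X\mid Z}(t\mid z)=P(X\le t\mid Z=z)$ and $Q_{X\mid Z}(\tau\mid z)=\inf\{t\in[0,1]:F_{X\mid Z}(t\mid z)\ge\tau\}$; similarly for $Y$. $U_1=F_{X\mid Z}(X\mid Z)$, $U_2=F_{Y\mid Z}(Y\mid Z)$. $(X_i,Y_i,Z_i)_{i=1}^n$ is an i.i.d. sample from $P$. An estimator $\hat F^{(n)}_{X\mid Z}$ is a mapping from the sample $(X_i,Z_i)_{i=1}^n$ to functions $\hat F^{(n)}_{X\mid Z}(\cdot\mid z):[0,1]\to[0,1]$ that for every $z\in[0,1]^d$ are continuous and increasing with value $0$ at $0$ and $1$ at $1$; similarly $\hat F^{(n)}_{Y\mid Z}$ is such a mapping from $(Y_i,Z_i)_{i=1}^n$. Put $\hat U_{1,i}=\hat F^{(n)}_{X\mid Z}(X_i\mid Z_i)$ and $\hat U_{2,i}=\hat F^{(n)}_{Y\mid Z}(Y_i\mid Z_i)$. The function $\phi=(\phi_1,\dots,\phi_q):[0,1]\to\mathbb{R}^q$ satisfies: each $\phi_k$ has support $\mathcal{T}_k$ that is a compact subset of $(0,1)$; each $\phi_k$ is Lipschitz continuous;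 $\int_0^1\phi_k(u)\,\mathrm{d}u=0$ and $\int_0^1\phi_k(u)^2\,\mathrm{d}u=1$; $\phi_1,\dots,\phi_q$ are linearly independent. $\hat\rho_n=\frac1n\sum_{i=1}^n\phi(\hat U_{1,i})\phi(\hat U_{2,i})^T$, $\Sigma_{k,s}=\int_0^1\phi_k(u)\phi_s(u)\,\mathrm{d}u$, and $T_n=\|\Sigma^{-1/2}\hat\rho_n\Sigma^{-1/2}\|_F^2$ with $\|\cdot\|_F$ the Frobenius norm. $\tau_{\min}=\inf(\mathcal{T}_1\cup\dots\cup\mathcal{T}_q)$, $\tau_{\max}=\sup(\mathcal{T}_1\cup\dots\cup\mathcal{T}_q)$, $\mathcal{T}=[\tau_{\min},\tau_{\max}]$. $\|f\|_{\mathcal{T},\infty}=\sup_{z\in[0,1]^d}\sup_{t\in Q_{X\mid Z}(\mathcal{T}\mid z)}|f(t,z)|$ with $Q_{X\mid Z}(\mathcal{T}\mid z)=[Q_{X\mid Z}(\tau_{\min}\mid z),Q_{X\mid Z}(\tau_{\max}\mid z)]$, and $\|f\|_{\mathcal{T}^c,\infty}$ is the same with the inner supremum over the complement $[0,1]\setminus Q_{X\mid Z}(\mathcal{T}\mid z)$. $\|\cdot\|'_{\mathcal{T},\infty}$ and $\|\cdot\|'_{\mathcal{T}^c,\infty}$ are defined in the same way with $Q_{Y\mid Z}$ in place of $Q_{X\mid Z}$. $X_n\in\mathcal{O}_P(a_n)$ (for a nonzero sequence $a_n$) means: for every $\epsilon>0$ there is $M>0$ with $\sup_nP(|X_n/a_n|>M)<\epsilon$.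 *)

(* Defs.v *)
From HB Require Import structures.
From mathcomp Require Export all_boot all_order all_algebra.
From mathcomp Require Export all_classical all_reals all_analysis.
Set Implicit Arguments.
Unset Strict Implicit.
Unset Printing Implicit Defensive.
Export Order.TTheory GRing.Theory Num.Theory.
Export numFieldNormedType.Exports.
Local Open Scope classical_set_scope.
Local Open Scope ring_scope.

(* An observation w = ((x, y), z) with x, y : R and z in R^d. *)
Notation obs R d := ((R * R) * d.-tuple R)%type.

Section distributions.
Context (R : realType) (d : nat).
Local Notation law := (probability (obs R d) R).

(* Lebesgue measure on R^m, as an m-fold product measure. *)
Fixpoint lebesgue_tuple (m : nat) : set (m.-tuple R) -> \bar R :=
  match m with
  | 0 => fun A => (\d_([tuple] : 0.-tuple R) A)%E
  | m'.+1 => pushforward (@lebesgue_measure R \x @lebesgue_tuple m')%E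
               (fun p => [tuple of p.1 :: p.2])
  end.

Definition lebesgue_obs : set (obs R d) -> \bar R :=
  ((@lebesgue_measure R \x @lebesgue_measure R) \x @lebesgue_tuple d)%E.

Definition cube : set (d.-tuple R) := [set z | forall i, tnth z i \in `[0, 1]].

Definition obs_cube : set (obs R d) :=
  (`[0, 1]%classic `*` `[0, 1]%classic) `*` cube.

Definition ac_laws : set law :=
  [set P | P obs_cube = 1%E /\ P `<< lebesgue_obs].

Definition coordX (w : obs R d) : R := w.1.1.
Definition coordY (w : obs R d) : R := w.1.2.
Definition coordZ (w : obs R d) : d.-tuple R := w.2.

(* k is a regular conditional distribution of V given Z under P. *)
Definition cond_law (V : obs R d -> R) (P : law) (k : R.-pker d.-tuple R ~> R) :=
  forall (A : set R) (C : set (d.-tuple R)), measurable A -> measurable C ->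
  P (V @^-1` A `&` coordZ @^-1` C)
  = (\int[P]_(w in coordZ @^-1` C) k (coordZ w) A)%E.

Definition cond_cdf (k : R.-pker d.-tuple R ~> R) (t : R) (z : d.-tuple R) : R :=
  fine (k z `]-oo, t]%classic).

(* A version of the conditional law of V given Z which, for every z in the
   cube, lives on [0, 1] and has a continuous distribution function. *)
Definition continuous_cond_law V P k :=
  [/\ cond_law V P k,
      (forall z, cube z -> k z `[0, 1]%classic = 1%E) &
      (forall z, cube z -> continuous (cond_cdf k ^~ z))].

Definition cond_quantile (k : R.-pker d.-tuple R ~> R) (tau : R)
    (z : d.-tuple R) : R :=
  inf [set t | t \in `[0, 1] /\ tau <= cond_cdf k t z].

(* The factorization does not depend on the versions kx, ky. *)
Definition cond_indep (P : law) :=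
  exists kx ky : R.-pker d.-tuple R ~> R,
  [/\ cond_law coordX P kx, cond_law coordY P ky &
      forall (A B : set R) (C : set (d.-tuple R)),
      measurable A -> measurable B -> measurable C ->
      P (coordX @^-1` A `&` coordY @^-1` B `&` coordZ @^-1` C)
      = (\int[P]_(w in coordZ @^-1` C)
           (kx (coordZ w) A * ky (coordZ w) B))%E].

Definition ci_laws : set law := [set P | ac_laws P /\ cond_indep P].

End distributions.

Section score_functions.
Context (R : realType) (q : nat).
Implicit Types (phi : 'I_q -> R -> R) (f : R -> R).

(* Score functions live on [0, 1]; their values elsewhere are irrelevant. *)
Definition support01 f : set R := closure [set u | u \in `[0, 1] /\ f u != 0].

Definition score_system phi :=
  [/\ (forall k, compact (support01 (phi k)) /\
         support01 (phi k) `<=` `]0, 1[%classic),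
      (forall k, [lipschitz (phi k : R^o -> R^o) u | u in `[0, 1]%classic]),
      (forall k, \int[lebesgue_measure]_(u in `[0, 1]) phi k u = 0),
      (forall k, \int[lebesgue_measure]_(u in `[0, 1]) (phi k u ^+ 2) = 1) &
      (forall c : 'I_q -> R,
         (forall u, u \in `[0, 1] -> \sum_k c k * phi k u = 0) ->
         forall k, c k = 0)].

Definition score_support phi : set R :=
  \bigcup_(k in [set: 'I_q]) support01 (phi k).
Definition tau_min phi : R := inf (score_support phi).
Definition tau_max phi : R := sup (score_support phi).

Definition score_gram phi : 'M[R]_q :=
  \matrix_(k, s) \int[lebesgue_measure]_(u in `[0, 1]) (phi k u * phi s u).

(* S^(-1/2): the unique symmetric positive semidefinite square root of S^-1. *)
Definition mx_invsqrt (S : 'M[R]_q) : 'M[R]_q :=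
  xget 0 [set B : 'M[R]_q | [/\ B^T = B,
    (forall v : 'rV[R]_q, 0 <= (v *m B *m v^T) 0 0) & B *m B = invmx S]].

Definition frobenius_sq (A : 'M[R]_q) : R := \sum_i \sum_j A i j ^+ 2.

End score_functions.

Section sup_norms.
Context (R : realType) (d q : nat).
Implicit Types (phi : 'I_q -> R -> R) (k : R.-pker d.-tuple R ~> R).

Definition quantile_range phi k (z : d.-tuple R) : set R :=
  `[cond_quantile k (tau_min phi) z, cond_quantile k (tau_max phi) z]%classic.

Definition sup_norm_on (S : d.-tuple R -> set R) (f : R -> d.-tuple R -> R) :
    \bar R :=
  ereal_sup [set e | exists z t, [/\ cube z, S z t & e = `|f t z|%:E]].

Definition sup_norm_in phi k := sup_norm_on (quantile_range phi k).

Definition sup_norm_out phi k :=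
  sup_norm_on (fun z => `[0, 1]%classic `\` quantile_range phi k z).

End sup_norms.

Section sampling.
Context (R : realType) (d : nat) (dO : measure_display).
Context (Omega : measurableType dO) (Pr : probability Omega R).

(* X_n is O_P(a_n) for n >= 1.  The suprema to which this is applied need not
   be measurable, hence the outer probability, which agrees with Pr on
   measurable events. *)
Definition bigO_prob (X : nat -> Omega -> \bar R) (a : nat -> R) :=
  (forall n, (0 < n)%N -> a n != 0) /\
  forall eps : R, 0 < eps -> exists2 M : R, 0 < M &
    (ereal_sup [set mu_ext Pr [set w | M%:E < `|X n w * ((a n)^-1)%:E|]
               | n in [set n | (0 < n)%N]] < eps%:E)%E.

(* The joint law of W 0, ..., W (n - 1) is the n-fold product of P. *)
Definition iid_sample (P : probability (obs R d) R)
    (W : nat -> {mfun Omega >-> obs R d}) :=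
  forall n (A : 'I_n -> set (obs R d)), (forall i, measurable (A i)) ->
  Pr (\bigcap_(i in [set: 'I_n]) (W i @^-1` A i)) = (\prod_(i < n) P (A i))%E.

Definition sampleXZ (W : nat -> Omega -> obs R d) n (w : Omega) :
    n.-tuple (R * d.-tuple R) := [tuple (coordX (W i w), coordZ (W i w)) | i < n].
Definition sampleYZ (W : nat -> Omega -> obs R d) n (w : Omega) :
    n.-tuple (R * d.-tuple R) := [tuple (coordY (W i w), coordZ (W i w)) | i < n].

End sampling.

Section test_statistic.
Context (R : realType) (d q : nat).

(* F n s t z is the estimate at (t | z) computed from the sample s of size n. *)
Definition cdf_rule := forall n, n.-tuple (R * d.-tuple R) -> R -> d.-tuple R -> R.

(* "Increasing" is read as nondecreasing. *)
Definition cdf_estimator (F : cdf_rule) :=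
  forall n (s : n.-tuple (R * d.-tuple R)), (0 < n)%N ->
  (forall i, (tnth s i).1 \in `[0, 1] /\ cube (tnth s i).2) ->
  forall z, cube z ->
  [/\ (forall t, t \in `[0, 1] -> F n s t z \in `[0, 1]),
      {within `[0, 1], continuous (F n s ^~ z)},
      {in `[0, 1] &, {homo F n s ^~ z : t u / t <= u}},
      F n s 0 z = 0 & F n s 1 z = 1].

Context (dO : measure_display) (Omega : measurableType dO).
Context (phi : 'I_q -> R -> R) (FX FY : cdf_rule) (W : nat -> Omega -> obs R d).

Definition Uhat1 n i (w : Omega) : R :=
  FX (sampleXZ W n w) (coordX (W i w)) (coordZ (W i w)).
Definition Uhat2 n i (w : Omega) : R :=
  FY (sampleYZ W n w) (coordY (W i w)) (coordZ (W i w)).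

Definition rho_hat n (w : Omega) : 'M[R]_q :=
  \matrix_(k, l) (n%:R^-1 * \sum_(i < n) phi k (Uhat1 n i w) * phi l (Uhat2 n i w)).

Definition T_stat n (w : Omega) : R :=
  let S := mx_invsqrt (score_gram phi) in
  frobenius_sq (S *m rho_hat n w *m S).

(* E_P (phi(U_1) phi(U_2)^T) with U_1 = F_{X|Z}(X|Z) and U_2 = F_{Y|Z}(Y|Z). *)
Definition rho (P : probability (obs R d) R) (kX kY : R.-pker d.-tuple R ~> R) :
    'M[R]_q :=
  \matrix_(k, l) fine ('E_P[fun w : obs R d =>
    (phi k (cond_cdf kX (coordX w) (coordZ w)) *
     phi l (cond_cdf kY (coordY w) (coordZ w)))%R])%E.

End test_statistic.

Section chi_squared.
Context (R : realType).

Definition gamma_fun (a : R) : R :=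
  \int[lebesgue_measure]_(t in `]0, +oo[) (t `^ (a - 1) * expR (- t)).

Definition chi2_pdf (m : nat) (x : R) : R :=
  if 0 < x then
    (2 `^ (m%:R / 2) * gamma_fun (m%:R / 2))^-1 *
    (x `^ (m%:R / 2 - 1) * expR (- x / 2))
  else 0.

Definition chi2_cdf (m : nat) (x : R) : R :=
  \int[lebesgue_measure]_(t in `]-oo, x]) chi2_pdf m t.

Definition chi2_quantile (m : nat) (p : R) : R :=
  inf [set x | p <= chi2_cdf m x].

End chi_squared.

(* The rejection indicator.  No measurability of the estimators is assumed; the
   library integral of a nonnegative function is the supremum over the simple
   functions below it, so the expectation of the indicator is in general the
   inner probability of rejection. *)
Definition test_Psi (R : realType) (d q : nat) (dO : measure_display)
    (Omega : measurableType dO) (phi : 'I_q -> R -> R) (FX FY : cdf_rule R d)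
    (W : nat -> Omega -> obs R d) (alpha : R) (n : nat) : Omega -> R :=
  \1_[set w | n%:R^-1 * chi2_quantile (q ^ 2) (1 - alpha) < T_stat phi FX FY W n w].

(* Main.v *)
Require Import Defs.
From HB Require Import structures.
From mathcomp Require Import complex spectral sesquilinear.
From mathcomp Require Import measurable_realfun lra ring.
Local Open Scope classical_set_scope.
Local Open Scope ring_scope.

(** Why the test has power.  Fix [P] and an entry [(k, l)] at which
    [rho = E_P(phi(U_1) phi(U_2)^T)] does not vanish.  The rejection threshold
    is a constant divided by [n], so it is enough to keep [T_n] above a fixed
    positive number with probability tending to one.

    - [T_n] controls the entries of [rho_hat]: the Gram matrix of the scores is
      positive definite because the scores are continuous and linearly
      independent ([score_gram_posdef]), hence its inverse has a positive
      semidefinite square root ([posdef_invsqrt]), which is invertible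
      ([invsqrt_gram_unit]), and conjugating by an invertible matrix distorts
      the Frobenius norm by at most a constant factor ([frobenius_conj_lb]).

    - [rho_hat] is uniformly close to the oracle average of
      [phi_k(U_1) phi_l(U_2)], which uses the true conditional distribution
      functions ([rho_hat_near_oracle]).  Inside the quantile range this is the
      Lipschitz property of the scores.  To the left of it, [phi_k(U_1)] is
      zero; monotonicity bounds the estimate by its value at the left end point
      of the range, which exceeds [tau_min] by at most the estimation error
      inside the range, and the score grows from its zero at [tau_min] at
      Lipschitz speed.  The right side is symmetric ([score_plugin]).  The error
      inside the range therefore controls everything.

    - The oracle average converges to [rho] in probability by the weak law of
      large numbers ([weak_law_of_large_numbers]).

    All exceptional events are enclosed in measurable events of small
    probability; the expectation of the possibly nonmeasurable rejection
    indicator is then bounded below by monotonicity of the integral of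
    arbitrary nonnegative functions ([le_integral_nonmeasurable]). *)

Set Implicit Arguments.
Unset Strict Implicit.
Unset Printing Implicit Defensive.

(** * Square roots of positive definite matrices *)

(** Newton's scheme: a node is added by correcting with a multiple of the
    polynomial that vanishes at the earlier nodes. *)
Lemma poly_interpolation (F : fieldType) (f : F -> F) (s : seq F) :
  exists p : {poly F}, {in s, forall x, p.[x] = f x}.
Proof.
elim: s => [|x s [p ps]]; first by exists 0.
have [xs|xs] := boolP (x \in s).
  by exists p => y; rewrite inE => /predU1P[->|]; exact: ps.
pose r : {poly F} := \prod_(y <- s) ('X - y%:P).
have rx : r.[x] != 0 by rewrite -rootE root_prod_XsubC.
exists (p + ((f x - p.[x]) / r.[x])%:P * r) => y; rewrite inE => /predU1P[->|ys].
  by rewrite !hornerE divfK// addrC subrK.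
have /eqP r0 : r.[y] == 0 by rewrite -rootE root_prod_XsubC.
by rewrite !hornerE r0 mulr0 addr0 ps.
Qed.

(** The spectral theorem for Hermitian matrices, applied over [R[i]].  The
    extension field and the embedding are left abstract in the statement: the
    only fact about them used later is that ring morphisms of fields reflect
    equalities and eigenvalues, and abstraction keeps unification away from the
    several algebraic structures carried by [R[i]]. *)
Lemma symmetric_diagonalizable (R : rcfType) n (A : 'M[R]_n) : A^T = A ->
  exists (C : fieldType) (f : {rmorphism R -> C}) (V : 'M[C]_n) (a : 'rV[R]_n),
    V \in unitmx /\ map_mx f A = invmx V *m diag_mx (map_mx f a) *m V.
Proof.
move=> AT; pose AC := map_mx (real_complex R) A.
have ACh : AC \is hermsymmx.
  apply: realsym_hermsym.
    by apply/is_hermitianmxP; rewrite expr0 scale1r map_mx_id// map_trmx AT.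
  by apply/mxOverP => i j; rewrite mxE complex_real.
exists R[i], (real_complex R), (spectralmx AC),
  (map_mx (@complex.Re R) (spectral_diag AC)); split.
  exact: spectral_unit.
have -> : map_mx (real_complex R) (map_mx (@complex.Re R) (spectral_diag AC))
    = spectral_diag AC.
  apply/matrixP => i j; rewrite !mxE RRe_real//.
  by have /mxOverP := hermitian_spectral_diag_real ACh; apply.
exact/orthomx_spectralP/hermitian_normalmx.
Qed.

(** The root is sought among the polynomials in [A], which are real and
    symmetric by construction; two of them are equal as soon as they agree on
    the eigenvalues.  If [r] interpolates [a |-> a^(-1/4)] there, then [r(A)^2]
    is an inverse square root, and it is positive semidefinite because it is
    the square of a symmetric matrix. *)
Lemma posdef_invsqrt (R : rcfType) n (A : 'M[R]_n) : A^T = A ->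
  (forall v : 'rV[R]_n, v != 0 -> 0 < (v *m A *m v^T) 0 0) ->
  exists B : 'M[R]_n, [/\ B^T = B,
    forall v : 'rV[R]_n, 0 <= (v *m B *m v^T) 0 0 & B *m B = invmx A].
Proof.
case: n A => [|n] A AT Apos.
  by exists 0; split=> [|v|]; [exact: flatmx0| rewrite mulmx0 mul0mx mxE |
    rewrite [LHS]flatmx0 [RHS]flatmx0].
have [C [f [V [a [Vu AE]]]]] := symmetric_diagonalizable AT.
(* The rows of [V] are eigenvectors over the extension; since the
   characteristic polynomial has coefficients in [R], each eigenvalue also has
   an eigenvector over [R], on which positivity can be tested. *)
have a_gt0 i : 0 < a 0 i.
  have : eigenvalue A (a 0 i).
    rewrite eigenvalue_root_char -(fmorph_root f) map_char_poly /=.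
    rewrite -eigenvalue_root_char; apply/eigenvalueP; exists (row i V).
      rewrite AE -row_mul !mulmxA mulmxV// mul1mx row_mul row_diag_mx mxE.
      by rewrite -scalemxAl -rowE.
    apply: contraTneq Vu => V0; apply: contraL (oner_neq0 C) => Vu.
    have /matrixP/(_ 0 i) : row i (V *m invmx V) = row i 1%:M by rewrite mulmxV.
    by rewrite row_mul V0 mul0mx !mxE eqxx mulr1n eq_sym => <-; rewrite eqxx.
  move=> /eigenvalueP[v vA v0].
  have := Apos v v0; rewrite vA -scalemxAl mxE.
  have v2 : 0 <= (v *m v^T) 0 0.
    by rewrite mxE sumr_ge0// => j _; rewrite mxE -expr2 sqr_ge0.
  by move=> vAv; rewrite ltNge; apply: contraL vAv => a_le0; rewrite -leNgt mulr_le0_ge0.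
have hornerA (p : {poly R}) : map_mx f (horner_mx A p)
    = invmx V *m diag_mx (map_mx f (map_mx (horner p) a)) *m V.
  have -> : map_mx f (map_mx (horner p) a)
      = map_mx (horner (map_poly f p)) (map_mx f a).
    by apply/matrixP => i j; rewrite !mxE horner_map.
  have -> : map_mx f (horner_mx A p)
      = horner_mx (map_mx f A) (map_poly f p).
    exact: map_horner_mx.
  by rewrite AE horner_mx_uconjC// horner_mx_diag.
have horner_eq (p r : {poly R}) : (forall i, p.[a 0 i] = r.[a 0 i]) ->
    horner_mx A p = horner_mx A r.
  move=> pr; apply: (@map_mx_inj _ _ f); rewrite !hornerA.
  suff -> : map_mx (horner p) a = map_mx (horner r) a by [].
  by apply/matrixP => i j; rewrite !mxE ord1 pr.
have horner_sym (p : {poly R}) : (horner_mx A p)^T = horner_mx A p.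
  elim/poly_ind: p => [|p c IH]; first by rewrite rmorph0 trmx0.
  rewrite rmorphD rmorphM/= horner_mx_X horner_mx_C linearD/= tr_scalar_mx.
  by rewrite trmx_mul AT IH; congr (_ + _); exact: comm_mx_horner.
have [r rE] := poly_interpolation
  (fun x => Num.sqrt (Num.sqrt x^-1)) [seq a 0 i | i : 'I_n.+1].
have {}rE i : r.[a 0 i] = Num.sqrt (Num.sqrt (a 0 i)^-1).
  by apply: rE; apply/mapP; exists i => //; rewrite mem_enum.
exists (horner_mx A (r ^+ 2)); split => [//|v|].
  have -> : v *m horner_mx A (r ^+ 2) *m v^T
      = (v *m horner_mx A r) *m (v *m horner_mx A r)^T.
    by rewrite trmx_mul horner_sym rmorphXn/= expr2 !mulmxA.
  by rewrite mxE sumr_ge0// => j _; rewrite [X in _ * X]mxE -expr2 sqr_ge0.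
have AB : horner_mx A (r ^+ 2) *m horner_mx A (r ^+ 2) *m A = 1%:M.
  rewrite -[X in _ *m X](horner_mx_X A) -[_ *m _ *m _]/(_ * _ * _) -!rmorphM/=.
  rewrite -(horner_mx_C A 1); apply: horner_eq => i.
  rewrite hornerM hornerX hornerM !horner_exp rE -expr2.
  rewrite !sqr_sqrtr ?sqrtr_ge0 ?invr_ge0 ?ltW//.
  by rewrite mulVf ?hornerC ?gt_eqF.
have [_ Au] := mulmx1_unit AB.
by rewrite -[LHS](mulmxK Au) AB mul1mx.
Qed.

(** * Integrals of real functions *)

Lemma Rintegral_sum d (T : measurableType d) (R : realType)
    (mu : {measure set T -> \bar R}) (D : set T) (I : Type) (s : seq I)
    (f : I -> T -> R) : measurable D ->
  (forall i, mu.-integrable D (EFin \o f i)) ->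
  \int[mu]_(x in D) (\sum_(i <- s) f i x) = \sum_(i <- s) \int[mu]_(x in D) f i x.
Proof.
move=> mD intf; rewrite /Rintegral.
under eq_integral do rewrite -sumEFin.
rewrite integral_sum//= sum_fine// => i _.
exact: integrable_fin_num (intf i).
Qed.

Lemma bounded_integrable dd (T : measurableType dd) (R : realType)
    (Q : probability T R) (f : T -> R) (K : R) :
  measurable_fun setT f -> (forall x, `|f x| <= K) ->
  Q.-integrable setT (EFin \o f).
Proof.
move=> mf fK; apply: measurable_bounded_integrable => //.
  exact: le_lt_trans (probability_le1 Q measurableT) (ltey _).
exists K; split; first exact: num_real.
by move=> M KM x _; rewrite /= (le_trans (fK x))// ltW.
Qed.

Lemma Rintegral_prob_cst dd (T : measurableType dd) (R : realType)
    (Q : probability T R) (r : R) : \int[Q]_x r = r.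
Proof. by rewrite /Rintegral; have := expectation_cst Q r; rewrite unlock => ->. Qed.

(** Otherwise [g] is nonzero on a nondegenerate interval, while it vanishes
    almost everywhere. *)
Lemma continuous_sq_integral_eq0 (R : realType) (g : R -> R) : continuous g ->
  (\int[lebesgue_measure]_(u in `[0, 1]) (g u ^+ 2)) = 0 ->
  forall u, u \in `[0, 1] -> g u = 0.
Proof.
move=> gc ig u u01; apply/eqP/negP => /negP gu.
have g2c : continuous (fun u => g u ^+ 2).
  by move=> x; under eq_fun do rewrite expr2; apply: cvgM; exact: gc.
have ig2 : lebesgue_measure.-integrable `[(0:R), 1] (EFin \o (fun u => g u ^+ 2)).
  apply: continuous_compact_integrable; first exact: segment_compact.
  exact: continuous_subspaceT.
have i0 : (\int[lebesgue_measure]_(x in `[0%R, 1%R]) `|(g x ^+ 2)%:E| = 0)%E.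
  under eq_integral do rewrite gee0_abs ?lee_fin ?sqr_ge0//.
  rewrite -(fineK (integrable_fin_num _ ig2))//.
  by rewrite [fine _]ig.
have [/(_ i0) + _] := @ae_eq_integral_abs _ _ R lebesgue_measure _
  (measurable_itv `[(0:R), 1]) _ (measurable_int _ ig2).
move=> [N [mN N0 gN]].
have /cvgrPdist_lt/(_ `|g u|) := gc u; rewrite normr_gt0 gu => /(_ isT).
move=> /nbhs_ballP[e /= e0 ue].
pose a := Num.max 0 (u - e); pose b := Num.min 1 (u + e).
move: (u01); rewrite in_itv/= => /andP[u0 u1].
have ab : a < b.
  by rewrite /a /b gt_max !lt_min ltr01 ltr_pwDr//=; lra.
have abN : `]a, b[%classic `<=` N.
  move=> v /=; rewrite in_itv/= /a /b gt_max lt_min => /andP[/andP[v0 ve] /andP[v1 ve']].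
  apply: gN => /=; apply/not_implyP; split; first by rewrite in_itv/= !ltW.
  move=> [] /eqP; rewrite sqrf_eq0 => /eqP gv0.
  have /= := ue v; rewrite gv0 subr0 ltxx => /(_ _)/notF; apply.
  by rewrite /ball/= ltr_distlC; apply/andP; split; lra.
have : (lebesgue_measure `]a, b[%classic <= lebesgue_measure N)%E.
  by apply: le_measure; rewrite ?inE.
by rewrite N0 lebesgue_measure_itv/= lte_fin ab -EFinB lee_fin subr_le0 leNgt ab.
Qed.

(** The integral of a nonnegative function is a supremum over the simple
    functions below it, which is monotone for arbitrary functions; the rejection
    event of an arbitrary estimator may fail to be measurable. *)
Lemma le_integral_nonmeasurable dd (T : measurableType dd) (R : realType)
    (mu : {measure set T -> \bar R}) (f g : T -> \bar R) :
  (forall x, 0 <= f x)%E -> (forall x, f x <= g x)%E ->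
  (\int[mu]_x f x <= \int[mu]_x g x)%E.
Proof.
move=> f0 fg; rewrite !ge0_integralE//; last first.
  by move=> x _; rewrite (le_trans (f0 x)).
apply: le_ereal_sup => _ [h /= hf <-]; exists h => //= x.
by rewrite (le_trans (hf x))// !patch_setT.
Qed.

(** * Score functions *)

Section score.
Context (R : realType) (q : nat) (phi : 'I_q -> R -> R).
Hypothesis phi_score : score_system phi.

Lemma score_lipschitz : exists2 L : R, 0 < L & forall k u v,
  u \in `[0, 1] -> v \in `[0, 1] -> `|phi k u - phi k v| <= L * `|u - v|.
Proof.
have [_ lip _ _ _] := phi_score.
have /choice[M MP] : forall k, exists M : R, 0 < M /\ forall u v,
    u \in `[0, 1] -> v \in `[0, 1] -> `|phi k u - phi k v| <= M * `|u - v|.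
  move=> k; have [M0 [_ HM]] := lip k.
  exists (Num.max 1 (M0 + 1)); split; first by rewrite lt_max ltr01.
  move=> u v u01 v01.
  by apply: (HM (Num.max 1 (M0 + 1)) _ (u, v)); rewrite ?lt_max ?ltrDl ?ltr01 ?orbT.
exists (1 + \sum_k M k) => [|k u v u01 v01].
  by rewrite ltr_pwDl// sumr_ge0// => k _; have [/ltW] := MP k.
have [_ /(_ u v u01 v01) /le_trans] := MP k; apply.
rewrite ler_wpM2r// (bigD1 k)//= addrCA lerDl addr_ge0// sumr_ge0// => j _.
by have [/ltW] := MP j.
Qed.

(** Scores are constrained on [0, 1] only; precomposing with the projection
    onto [0, 1] makes the continuity results on the whole line available. *)
Lemma score_extension : exists psi : 'I_q -> R -> R,
  (forall k, continuous (psi k)) /\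
  (forall k u, u \in `[0, 1] -> psi k u = phi k u).
Proof.
have [L L0 phiL] := score_lipschitz.
pose c (u : R) := Num.max 0 (Num.min 1 u).
have c01 u : c u \in `[0, 1].
  by rewrite in_itv /= /c le_max lexx/= ge_max ler01/= ge_min lexx.
have cc : continuous c.
  move=> u; apply: (@continuous_max _ _ (cst 0) (fun x : R => Num.min 1 x)).
    exact: cvg_cst.
  by apply: (@continuous_min _ _ (cst 1) (fun x : R => x));
    [exact: cvg_cst|exact: cvg_id].
exists (fun k => phi k \o c); split => [k u|k u u01]; last first.
  by move: u01; rewrite in_itv/= => /andP[u0 u1]; rewrite /= /c min_r// max_r.
apply/cvgrPdist_le => /= e e0.
have /cvgrPdist_le/(_ (e / L)) := cc u.
rewrite divr_gt0// => /(_ isT); apply: filterS => v cuv.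
by rewrite (le_trans (phiL k _ _ (c01 u) (c01 v)))// mulrC -ler_pdivlMr.
Qed.

Lemma score_gram_sym : (score_gram phi)^T = score_gram phi.
Proof.
apply/matrixP => i j; rewrite !mxE; congr fine; apply: eq_integral => x _.
by rewrite mulrC.
Qed.

(** [v G v^T] is the integral of [(\sum_k v_k phi_k)^2], which vanishes for
    [v = 0] only, by linear independence. *)
Lemma score_gram_posdef (v : 'rV[R]_q) : v != 0 ->
  0 < (v *m score_gram phi *m v^T) 0 0.
Proof.
have [psi [psic psiE]] := score_extension => v0.
have [_ _ _ _ free_phi] := phi_score.
pose g u := \sum_k v 0 k * psi k u.
have gc : continuous g.
  apply: continuous_big => [|k _ x]; first exact: add_continuous.
  by apply: cvgM; [exact: cvg_cst|exact: psic].
have int_psi k l c : lebesgue_measure.-integrable `[(0:R), 1]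
    (EFin \o (fun u => c * (psi k u * psi l u))).
  apply: continuous_compact_integrable; first exact: segment_compact.
  apply: continuous_subspaceT => x; apply: cvgM; first exact: cvg_cst.
  by apply: cvgM; exact: psic.
have -> : (v *m score_gram phi *m v^T) 0 0
    = \int[lebesgue_measure]_(u in `[0, 1]) (g u ^+ 2).
  transitivity (\sum_(p : 'I_q * 'I_q) \int[lebesgue_measure]_(u in `[0, 1])
      (v 0 p.1 * v 0 p.2 * (psi p.1 u * psi p.2 u))).
    rewrite -(pair_bigA _ (fun k l => \int[lebesgue_measure]_(u in `[0, 1])
      (v 0 k * v 0 l * (psi k u * psi l u))))/= exchange_big/= mxE.
    apply: eq_bigr => l _; rewrite !mxE mulr_suml; apply: eq_bigr => k _.
    rewrite RintegralZl//; last first.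
      by have := int_psi k l 1; apply: eq_integrable => // u _; rewrite /= mul1r.
    rewrite mxE mulrAC; congr (_ * _); apply: eq_Rintegral => u /[!inE] u01.
    by rewrite !psiE.
  rewrite -Rintegral_sum//; apply: eq_Rintegral => u _.
  rewrite -(pair_bigA _ (fun k l => v 0 k * v 0 l * (psi k u * psi l u)))/=.
  rewrite expr2 mulr_suml; apply: eq_bigr => k _; rewrite mulr_sumr.
  by apply: eq_bigr => l _; rewrite mulrACA.
rewrite lt_neqAle Rintegral_ge0 ?andbT; last by move=> x _; rewrite sqr_ge0.
apply: contra_neq v0 => /esym ig; apply/rowP => k; rewrite mxE.
apply: (free_phi (v 0)) => u u01.
rewrite -[RHS](continuous_sq_integral_eq0 gc ig u01); apply: eq_bigr => j _.
by rewrite psiE.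
Qed.

Lemma score_support_sub : score_support phi `<=` `]0, 1[%classic.
Proof. by have [supp _ _ _ _] := phi_score; move=> u [k _]; apply: (supp k).2. Qed.

Lemma score_support_neq0 k u : u \in `[0, 1] -> phi k u != 0 ->
  score_support phi u.
Proof. by move=> u01 pu; exists k => //; apply: subset_closure. Qed.

Lemma score_neq0_between k u : u \in `[0, 1] -> phi k u != 0 ->
  tau_min phi <= u <= tau_max phi.
Proof.
move=> u01 /(score_support_neq0 u01) su; apply/andP; split.
  apply: ge_inf => //; exists 0 => v /score_support_sub.
  by rewrite /= in_itv/= => /andP[/ltW].
apply: ub_le_sup => //; exists 1 => v /score_support_sub.
by rewrite /= in_itv/= => /andP[_ /ltW].
Qed.

Lemma score_exists_neq0 k : exists2 u, u \in `[0, 1] & phi k u != 0.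
Proof.
have [_ _ _ norm1 _] := phi_score.
apply/not_exists2P => phi0; have := norm1 k.
under eq_Rintegral => u u01.
  have -> : phi k u = 0
    by apply/eqP/negPn/negP; have [/(_ _)|//] := phi0 u; rewrite inE in u01.
  rewrite expr0n/=; over.
by rewrite Rintegral_cst// mul0r => /esym/eqP; rewrite oner_eq0.
Qed.

Lemma tau_bounds (q_gt0 : (0 < q)%N) :
  [/\ 0 <= tau_min phi, tau_min phi <= tau_max phi & tau_max phi <= 1].
Proof.
have [u u01 pu] := score_exists_neq0 (Ordinal q_gt0).
have su := score_support_neq0 u01 pu.
split.
- apply: lb_le_inf; first by exists u.
  by move=> v /score_support_sub; rewrite /= in_itv/= => /andP[/ltW].
- by have /andP[/le_trans] := score_neq0_between u01 pu; apply.
- apply: ge_sup; first by exists u.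
  by move=> v /score_support_sub; rewrite /= in_itv/= => /andP[_ /ltW].
Qed.

(** The set where a score is nonzero is open in [0, 1] and lies between
    [tau_min] and [tau_max]; the end points are inside ]0, 1[, so a nonzero
    value there would persist slightly outside that interval. *)
Lemma score_outside k u : u \in `[0, 1] ->
  (u <= tau_min phi) || (tau_max phi <= u) -> phi k u = 0.
Proof.
move=> u01 uout; apply: contrapT => /eqP pu.
have := score_support_sub (score_support_neq0 u01 pu).
rewrite /= in_itv/= => /andP[u0 u1].
have /andP[mu uM] := score_neq0_between u01 pu.
have [L L0 phiL] := score_lipschitz.
have pu0 : 0 < `|phi k u| by rewrite normr_gt0.
(* [s] is the direction that leaves the interval [tau_min, tau_max]. *)
have {uout} [s s1 suout] : exists2 s : R, `|s| = 1 & forall e, 0 < e ->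
    u + s * e < tau_min phi \/ tau_max phi < u + s * e.
  have [mE|mE] := orP uout.
    by exists (-1); rewrite ?normrN1// => e e0; left; lra.
  by exists 1; rewrite ?normr1// => e e0; right; lra.
(* A step short enough to stay in [0, 1] and to keep the score nonzero. *)
pose e := Num.min (`|phi k u| / (2 * L)) (Num.min u (1 - u)).
have e0 : 0 < e by rewrite !lt_min !divr_gt0 ?mulr_gt0//= u0 subr_gt0.
have [eu eu1] : e <= u /\ e <= 1 - u by rewrite !ge_min !lexx !orbT.
have se : `|s * e| = e by rewrite normrM s1 mul1r gtr0_norm.
have v01 : u + s * e \in `[0, 1].
  rewrite in_itv/=; have := ler_norm (s * e); have := ler_norm (- (s * e)).
  by rewrite normrN se => ? ?; apply/andP; split; lra.
have pv : phi k (u + s * e) = 0.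
  apply: contrapT => /eqP /(score_neq0_between v01)/andP[? ?].
  by have [|] := suout _ e0; lra.
have := phiL k _ _ u01 v01; rewrite pv subr0 opprD addrA subrr sub0r normrN se.
apply/negP; rewrite -ltNge mulrC -ltr_pdivlMr//.
by rewrite gt_min; apply/orP; left; rewrite ltr_pM2l// ltf_pV2 ?posrE ?mulr_gt0//; lra.
Qed.

End score.

(** * Conditional distribution functions and the plug-in error *)

Section cdf.
Context (R : realType) (d : nat) (k : R.-pker d.-tuple R ~> R).

Lemma pkernel_le1 z A : measurable A -> (k z A <= 1)%E.
Proof. by move=> mA; rewrite -(prob_kernel (s := k) z) le_measure ?inE. Qed.

Lemma cond_cdfE t z : (cond_cdf k t z)%:E = k z `]-oo, t]%classic.
Proof. by rewrite /cond_cdf fineK// finite_kernel_measure. Qed.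

Lemma cond_cdf01 t z : cond_cdf k t z \in `[0, 1].
Proof.
by rewrite in_itv/= -!lee_fin cond_cdfE measure_ge0 pkernel_le1.
Qed.

Lemma cond_cdf_homo z : {homo cond_cdf k ^~ z : s t / s <= t}.
Proof.
move=> s t st; rewrite -lee_fin !cond_cdfE le_measure ?inE//.
by apply: subset_itvl; rewrite bnd_simp.
Qed.

Variable z : d.-tuple R.
Hypothesis k01 : k z `[0, 1]%classic = 1%E.
Hypothesis k_cont : continuous (cond_cdf k ^~ z).

Lemma cond_cdf1 : cond_cdf k 1 z = 1.
Proof.
apply/eqP; rewrite eq_le; have := cond_cdf01 1 z; rewrite in_itv/= => /andP[_ ->]/=.
by rewrite -lee_fin cond_cdfE -k01 le_measure ?inE//; apply: subset_itvr.
Qed.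

Lemma cond_cdf_lt0 t : t < 0 -> cond_cdf k t z = 0.
Proof.
move=> t0; apply/EFin_inj; rewrite cond_cdfE.
apply/eqP; rewrite eq_le measure_ge0 andbT.
have /= : (k z (`]-oo, t] `|` `[0%R, 1%R]) <= 1)%E.
  by apply: pkernel_le1; exact: measurableU.
rewrite measureU//.
  by rewrite [X in (_ + X)%E]k01 -[leRHS]add0e leeD2rE.
by apply/seteqP; split => // s []/=; rewrite !in_itv/= => st /andP[s0 _]; lra.
Qed.

Section quantile.
Variable tau : R.
Hypothesis tau01 : 0 <= tau <= 1.
Local Notation Q := (cond_quantile k tau z).

Let has_inf_level : has_inf [set t | t \in `[0, 1] /\ tau <= cond_cdf k t z].
Proof.
split.
  exists 1; split; first by rewrite in_itv/= ler01 lexx.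
  by rewrite cond_cdf1; case/andP: tau01.
by exists 0 => t []; rewrite in_itv/= => /andP[].
Qed.

Lemma cond_quantile01 : Q \in `[0, 1].
Proof.
rewrite in_itv/=; apply/andP; split.
  by apply: lb_le_inf => [|t []]; [exact: has_inf_level.1|rewrite in_itv/= => /andP[]].
apply: ge_inf; first exact: has_inf_level.2.
by split; [rewrite in_itv/= ler01 lexx|rewrite cond_cdf1; case/andP: tau01].
Qed.

Lemma cond_quantile_le t : t \in `[0, 1] -> tau <= cond_cdf k t z -> Q <= t.
Proof. by move=> t01 tF; apply: ge_inf; [exact: has_inf_level.2|]. Qed.

(** Left continuity gives [F(Q) <= tau] also when [Q = 0], since the
    distribution function is zero on the negative half-line. *)
Lemma cond_cdf_quantile : cond_cdf k Q z = tau.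
Proof.
have Q01 := cond_quantile01; move: (Q01); rewrite in_itv/= => /andP[Q0 Q1].
have /andP[tau0 tau1] := tau01.
apply/eqP; rewrite eq_le; apply/andP; split; rewrite leNgt; apply/negP => FQ.
  have /cvgrPdist_lt/(_ (cond_cdf k Q z - tau)) := @k_cont Q.
  rewrite subr_gt0 => /(_ FQ)/nbhs_ballP[e /= e0 Qe].
  have tQ : Q - e / 2 < Q by rewrite ltrBlDr ltrDl divr_gt0.
  have Ft : cond_cdf k (Q - e / 2) z <= tau.
    have [t0|t0] := ltP (Q - e / 2) 0; first by rewrite cond_cdf_lt0.
    rewrite leNgt; apply: contraL tQ => /ltW Ft; rewrite -leNgt cond_quantile_le//.
    by rewrite in_itv/= t0/= (le_trans _ Q1)// gerBl divr_ge0// ltW.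
  have := Qe (Q - e / 2); rewrite /ball/= ger0_norm ?subr_ge0 ?ltW// => /(_ _) {}Qe.
  have := Qe _; rewrite ger0_norm ?subr_ge0 ?cond_cdf_homo ?(ltW tQ)//.
  have : Q - (Q - e / 2) < e by lra.
  by move=> h /(_ h); lra.
have /cvgrPdist_lt/(_ (tau - cond_cdf k Q z)) := @k_cont Q.
rewrite subr_gt0 => /(_ FQ)/nbhs_ballP[e /= e0 Qe].
have [t [t01 tF] te] := inf_adherent e0 has_inf_level.
have Qt : Q <= t by exact: cond_quantile_le.
have := Qe t; rewrite /ball/= ltr_distlC => /(_ _).
have -> : Q - e < t < Q + e by apply/andP; split=> //; lra.
by move=> /(_ isT); rewrite ler0_norm ?subr_le0 ?cond_cdf_homo//; lra.
Qed.

End quantile.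

Section plugin.
Context (q : nat) (phi : 'I_q -> R -> R).
Hypothesis phi_score : score_system phi.
Variables (L : R).
Hypothesis L_ge0 : 0 <= L.
Hypothesis phi_lip : forall j u v, u \in `[0, 1] -> v \in `[0, 1] ->
  `|phi j u - phi j v| <= L * `|u - v|.

(** [G] is compared with the true distribution function on the quantile range
    only, yet the scores are close at every [x]: beyond the range the true score
    is zero, and monotonicity of [G] together with its accuracy at the nearest
    end point confines [G x] to within [e] of the zero set of the score. *)
Lemma score_plugin (G : R -> R) (e : R) (j : 'I_q) x :
  (forall t, t \in `[0, 1] -> G t \in `[0, 1]) ->
  {in `[0, 1] &, {homo G : t u / t <= u}} ->
  (forall t, quantile_range phi k z t -> `|cond_cdf k t z - G t| <= e) ->
  x \in `[0, 1] ->
  `|phi j (cond_cdf k x z) - phi j (G x)| <= L * e.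
Proof.
move=> G01 G_homo Ge x01.
have q_gt0 : (0 < q)%N by case: {+}q j => [[]|].
have [m0 mM M1] := tau_bounds phi_score q_gt0.
have tm : 0 <= tau_min phi <= 1 by rewrite m0 (le_trans mM).
have tM : 0 <= tau_max phi <= 1 by rewrite M1 (le_trans m0).
set Qm := cond_quantile k (tau_min phi) z.
set QM := cond_quantile k (tau_max phi) z.
have Qm01 : Qm \in `[0, 1] by exact: cond_quantile01.
have QM01 : QM \in `[0, 1] by exact: cond_quantile01.
have FQm : cond_cdf k Qm z = tau_min phi by exact: cond_cdf_quantile.
have FQM : cond_cdf k QM z = tau_max phi by exact: cond_cdf_quantile.
have QmM : Qm <= QM by apply: cond_quantile_le => //; rewrite FQM.
have e0 : 0 <= e.
  apply: le_trans (Ge Qm _); first by rewrite normr_ge0.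
  by rewrite /quantile_range/= in_itv/= lexx.
have tm01 : tau_min phi \in `[0, 1] by rewrite in_itv.
have tM01 : tau_max phi \in `[0, 1] by rewrite in_itv.
have [xm|mx] := ltP x Qm.
  rewrite [phi j (cond_cdf k x z)](score_outside phi_score _ (cond_cdf01 _ _));
    last first.
    by apply/orP; left; rewrite -FQm cond_cdf_homo// ltW.
  have [Gm|mG] := leP (G x) (tau_min phi).
    by rewrite (score_outside phi_score _ (G01 _ x01)) ?Gm// subrr normr0 mulr_ge0.
  rewrite -(score_outside phi_score j tm01) ?lexx//.
  apply: (le_trans (phi_lip _ tm01 (G01 _ x01))); rewrite ler_wpM2l//.
  rewrite ler0_norm ?opprB; last by rewrite subr_le0 ltW.
  have := Ge Qm; rewrite FQm /quantile_range/= in_itv/= lexx => /(_ QmM).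
  have := G_homo _ _ x01 Qm01 (ltW xm) => Gx.
  rewrite distrC => /(le_trans (ler_norm _)); lra.
have [Mx|xM] := ltP QM x.
  rewrite [phi j (cond_cdf k x z)](score_outside phi_score _ (cond_cdf01 _ _));
    last first.
    by apply/orP; right; rewrite -FQM cond_cdf_homo// ltW.
  have [MG|GM] := leP (tau_max phi) (G x).
    by rewrite (score_outside phi_score _ (G01 _ x01)) ?MG ?orbT// subrr normr0 mulr_ge0.
  rewrite -(score_outside phi_score j tM01) ?lexx ?orbT//.
  apply: (le_trans (phi_lip _ tM01 (G01 _ x01))); rewrite ler_wpM2l//.
  rewrite ger0_norm; last by rewrite subr_ge0 ltW.
  have := Ge QM; rewrite FQM /quantile_range/= in_itv/= lexx andbT => /(_ QmM).
  have := G_homo _ _ QM01 x01 (ltW Mx) => Gx.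
  by move=> /(le_trans (ler_norm _)); lra.
apply: (le_trans (phi_lip _ (cond_cdf01 _ _) (G01 _ x01))); rewrite ler_wpM2l//.
by apply: Ge; rewrite /quantile_range/= in_itv/= mx xM.
Qed.

Lemma score_le (j : 'I_q) u : u \in `[0, 1] -> `|phi j u| <= L.
Proof.
move=> u01; have q_gt0 : (0 < q)%N by case: {+}q j => [[]|].
have [m0 mM M1] := tau_bounds phi_score q_gt0.
have z01 : 0 \in `[0, 1 : R] by rewrite in_itv/= lexx ler01.
have := phi_lip j u01 z01.
rewrite (score_outside phi_score _ z01) ?m0// !subr0 => /le_trans; apply.
by rewrite ler_piMr//; move: u01; rewrite in_itv/= => /andP[u0 u1]; rewrite ger0_norm.
Qed.

End plugin.
End cdf.

(** * The normalization of the test statistic *)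

Section statistic.
Context (R : realType) (q : nat) (phi : 'I_q -> R -> R).
Hypothesis phi_score : score_system phi.

(** [mx_invsqrt] is a choice with default value zero, so the existence of the
    square root is what excludes a degenerate statistic. *)
Lemma invsqrt_gram_unit : mx_invsqrt (score_gram phi) \in unitmx.
Proof.
set S := mx_invsqrt _.
have [_ _ SS] : [/\ S^T = S, forall v : 'rV[R]_q, 0 <= (v *m S *m v^T) 0 0 &
    S *m S = invmx (score_gram phi)].
  rewrite /S /mx_invsqrt; case: xgetP => [B _ //|noB].
  have [B BP] := posdef_invsqrt (score_gram_sym phi) (score_gram_posdef phi_score).
  by have := noB B.
have : S *m S \in unitmx.
  rewrite SS unitmx_inv -row_free_unit -kermx_eq0; apply/rowV0P => v /sub_kermxP vG.
  apply/eqP; apply: contraT => /(score_gram_posdef phi_score).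
  by rewrite vG mul0mx mxE ltxx.
by rewrite unitmx_mul => /andP[].
Qed.

(** [M = S^-1 (S M S) S^-1], and every entry of [S M S] is at most its
    Frobenius norm. *)
Lemma frobenius_conj_lb (S : 'M[R]_q) : S \in unitmx ->
  exists2 K : R, 0 < K &
    forall (M : 'M[R]_q) i j, `|M i j| ^+ 2 <= K * frobenius_sq (S *m M *m S).
Proof.
move=> Su; pose C := \sum_i \sum_j `|invmx S i j|.
have C0 : 0 <= C by rewrite sumr_ge0// => i _; rewrite sumr_ge0.
have SC i : \sum_j `|invmx S i j| <= C.
  rewrite /C [leRHS](bigD1 i)//= lerDl sumr_ge0// => j _; exact: sumr_ge0.
have CS j : \sum_i `|invmx S i j| <= C.
  rewrite /C exchange_big/= [leRHS](bigD1 j)//= lerDl sumr_ge0// => i _.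
  exact: sumr_ge0.
exists ((C * C) ^+ 2 + 1) => [|M i j]; first by rewrite ltr_pwDr// sqr_ge0.
set N := S *m M *m S; pose f := frobenius_sq N.
have f0 : 0 <= f.
  by rewrite sumr_ge0// => a _; rewrite sumr_ge0// => b _; rewrite sqr_ge0.
have Nf a b : `|N a b| <= Num.sqrt f.
  rewrite -(ler_pXn2r (ltn0Sn 1)) ?nnegrE ?sqrtr_ge0 ?normr_ge0// sqr_sqrtr//.
  rewrite real_normK ?num_real// /f /frobenius_sq (bigD1 a)//= (bigD1 b)//=.
  rewrite -addrA lerDl addr_ge0// sumr_ge0// => c _; rewrite ?sqr_ge0//.
  by rewrite sumr_ge0// => c' _; rewrite sqr_ge0.
have ME : M = invmx S *m N *m invmx S.
  by rewrite /N !mulmxA mulVmx// mul1mx -mulmxA mulmxV// mulmx1.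
have Mb : `|M i j| <= C * C * Num.sqrt f.
  rewrite ME mxE (le_trans (ler_norm_sum _ _ _))//.
  have : \sum_b C * Num.sqrt f * `|invmx S b j| <= C * C * Num.sqrt f.
    by rewrite -mulr_sumr [leRHS]mulrAC ler_wpM2l ?mulr_ge0 ?sqrtr_ge0.
  apply: le_trans; apply: ler_sum => b _; rewrite normrM ler_wpM2r//.
  rewrite mxE (le_trans (ler_norm_sum _ _ _))//.
  have : \sum_a `|invmx S i a| * Num.sqrt f <= C * Num.sqrt f.
    by rewrite -mulr_suml ler_wpM2r ?sqrtr_ge0.
  by apply: le_trans; apply: ler_sum => a _; rewrite normrM ler_wpM2l.
rewrite (le_trans (_ : _ <= (C * C * Num.sqrt f) ^+ 2))//.
  by rewrite ler_pXn2r ?nnegrE ?mulr_ge0 ?sqrtr_ge0.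
by rewrite exprMn sqr_sqrtr// ler_wpM2r// lerDl.
Qed.

End statistic.

(** * Measurability of conditional distribution functions *)

Section kernel_measurability.
Context (R : realType) (d : nat) (k : R.-pker d.-tuple R ~> R).

(** The conditional law indexed by the whole observation.  With this kernel the
    threshold of the distribution function, which depends on the first
    coordinates, becomes part of the section of a measurable set. *)
Definition obs_kernel (w : obs R d) : {measure set R -> \bar R} := k (coordZ w).

Let measurable_obs_kernel (U : set R) : measurable U ->
  measurable_fun [set: obs R d] (obs_kernel ^~ U).
Proof.
move=> mU; apply: (measurableT_comp (measurable_kernel k U mU)).
exact: measurable_snd.
Qed.

HB.instance Definition _ := isKernel.Build _ _ _ _ R obs_kernel measurable_obs_kernel.

Let obs_kernel1 w : obs_kernel w setT = 1%E.
Proof. exact: prob_kernel. Qed.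

HB.instance Definition _ := Kernel_isProbability.Build _ _ _ _ R obs_kernel obs_kernel1.

Lemma measurable_cond_cdf (V : obs R d -> R) : measurable_fun setT V ->
  measurable_fun setT (fun w => cond_cdf k (V w) (coordZ w)).
Proof.
move=> mV; pose A := [set p : obs R d * R | p.2 <= V p.1].
have mA : measurable A.
  rewrite -[A]setTI; apply: measurable_fun_le => //.
  exact: measurableT_comp.
apply: (measurableT_comp (fine_measurable measurableT)).
have := @measurable_fun_xsection_finite_kernel _ _ _ _ _ obs_kernel A.
rewrite inE => /(_ mA); apply: eq_measurable_fun => w _.
rewrite /= /obs_kernel; congr (k _ _).
by apply/seteqP; split => x; rewrite /xsection /= in_itv/= inE.
Qed.

End kernel_measurability.

(** * The weak law of large numbers *)

Section law_of_large_numbers.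
Context (R : realType) (d : nat) (dO : measure_display) (Omega : measurableType dO).
Context (Pr : probability Omega R) (P : probability (obs R d) R).
Context (W : nat -> {mfun Omega >-> obs R d}).
Hypothesis W_iid : iid_sample Pr P W.

Lemma iid_law i A : measurable A -> Pr (W i @^-1` A) = P A.
Proof.
move=> mA; pose B (j : 'I_i.+1) := if j == i :> nat then A else setT.
have mB j : measurable (B j) by rewrite /B; case: ifP.
have := W_iid mB; rewrite (bigD1 ord_max)//= big1 ?mule1.
  rewrite /B eqxx => <-; congr (Pr _); apply/seteqP; split => w /=.
    by move=> Aw j _ /=; case: eqP => // ->.
  by move=> /(_ ord_max I) /=; rewrite eqxx.
by move=> j ji; rewrite /B ifN ?probability_setT.
Qed.

(** The factors indexed by neither [i] nor [j] are filled with the full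
    space. *)
Lemma iid_pair_law i j A B : i != j -> measurable A -> measurable B ->
  Pr (W i @^-1` A `&` W j @^-1` B) = (P A * P B)%E.
Proof.
move=> ij mA mB.
pose n := (maxn i j).+1.
have ni : (i < n)%N by rewrite ltnS leq_maxl.
have nj : (j < n)%N by rewrite ltnS leq_maxr.
pose C (l : 'I_n) := if l == i :> nat then A else if l == j :> nat then B else setT.
have mC l : measurable (C l) by rewrite /C; case: ifP => //; case: ifP.
have := W_iid mC; rewrite (bigD1 (Ordinal ni))//= (bigD1 (Ordinal nj))/=; last first.
  by rewrite -val_eqE/= eq_sym.
rewrite big1 ?mule1; last first.
  by move=> l /andP[li lj]; rewrite /C (ifN _ _ li) (ifN _ _ lj) probability_setT.
rewrite {2 3}/C/= !eqxx [j == i]eq_sym (negbTE ij) => <-.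
congr (Pr _); apply/seteqP; split => w /=.
  by move=> [Aw Bw] l _ /=; rewrite /C; case: eqP => [->//|_]; case: eqP => [->|].
move=> Cw; split.
  by have := Cw (Ordinal ni) I; rewrite /= /C/= eqxx.
by have := Cw (Ordinal nj) I; rewrite /= /C/= eqxx eq_sym (negbTE ij).
Qed.

Definition sample_pair i j w : obs R d * obs R d := (W i w, W j w).

Let measurable_sample_pair i j : measurable_fun setT (sample_pair i j).
Proof. exact: measurable_fun_pair. Qed.

HB.instance Definition _ i j :=
  isMeasurableFun.Build _ _ _ _ (sample_pair i j) (measurable_sample_pair i j).

Variables (f : obs R d -> R) (K : R).
Hypothesis mf : measurable_fun setT f.
Hypothesis fK : forall x, `|f x| <= K.

(** The joint law of two distinct observations is the product measure, where
    Fubini's theorem factors the integral. *)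
Lemma iid_product_mean i j : i != j ->
  \int[Pr]_w (f (W i w) * f (W j w)) = (\int[P]_x f x) ^+ 2.
Proof.
move=> ij; pose F (p : obs R d * obs R d) := f p.1 * f p.2.
have mF : measurable_fun setT F.
  by apply: measurable_funM; exact: measurableT_comp.
have K0 : 0 <= K by apply: le_trans (fK point).
have FK p : `|F p| <= K * K by rewrite normrM ler_pM.
have fi : P.-integrable setT (EFin \o f) by exact: bounded_integrable fK.
transitivity (fine (\int[distribution Pr (sample_pair i j)]_p (F p)%:E)%E).
  congr fine; rewrite integral_distribution//=.
  - exact/measurable_EFinP.
  - apply: (@bounded_integrable _ _ _ Pr (F \o sample_pair i j) (K * K));
      last by move=> x /=.
    exact: measurableT_comp.
transitivity (fine (\int[(P \x P)%E]_p (F p)%:E)%E).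
  congr fine; apply: eq_measure_integral => A mA _.
  apply/esym; apply: product_measure_unique => // B C mB mC.
  exact: iid_pair_law.
rewrite -integral12_prod_meas1/=; last first.
  by apply: (@bounded_integrable _ _ _ (P \x P)%E F (K * K)).
rewrite /fubini_F/= /F/=.
under eq_integral.
  move=> x _; under eq_integral do rewrite EFinM.
  rewrite integralZl//= -(fineK (integrable_fin_num _ fi))//=.
  over.
by rewrite integralZr//= -{1}(fineK (integrable_fin_num _ fi))//= -EFinM expr2.
Qed.

End law_of_large_numbers.

Section weak_law.
Context (R : realType) (d : nat) (dO : measure_display) (Omega : measurableType dO).
Context (Pr : probability Omega R) (P : probability (obs R d) R).
Context (W : nat -> {mfun Omega >-> obs R d}).
Hypothesis W_iid : iid_sample Pr P W.
Variables (f : obs R d -> R) (K : R).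
Hypothesis mf : measurable_fun setT f.
Hypothesis fK : forall x, `|f x| <= K.

(** The cross terms of the square vanish, which leaves [n] diagonal terms. *)
Lemma iid_second_moment n : \int[P]_x f x = 0 ->
  \int[Pr]_w ((\sum_(i < n) f (W i w)) ^+ 2) <= n%:R * K ^+ 2.
Proof.
move=> f0.
have K0 : 0 <= K by apply: le_trans (fK point).
have intff i j : Pr.-integrable setT (EFin \o (fun w => f (W i w) * f (W j w))).
  apply: (@bounded_integrable _ _ _ _ _ (K * K)); last first.
    by move=> w; rewrite normrM ler_pM.
  by apply: measurable_funM; exact: measurableT_comp.
have -> : \int[Pr]_w ((\sum_(i < n) f (W i w)) ^+ 2)
    = \sum_(p : 'I_n * 'I_n) \int[Pr]_w (f (W p.1 w) * f (W p.2 w)).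
  rewrite -Rintegral_sum//; apply: eq_Rintegral => w _.
  rewrite -(pair_bigA _ (fun i j : 'I_n => f (W i w) * f (W j w)))/=.
  by rewrite expr2 mulr_suml; apply: eq_bigr => i _; rewrite mulr_sumr.
rewrite -(pair_bigA _ (fun i j : 'I_n => \int[Pr]_w (f (W i w) * f (W j w))))/=.
rewrite -[X in X%:R]card_ord -sum1_card natr_sum mulr_suml ler_sum// => i _.
rewrite mul1r (bigD1 i)//= big1 ?addr0; last first.
  by move=> j ji; rewrite (iid_product_mean W_iid mf fK) 1?eq_sym// f0 expr0n.
apply: le_trans (_ : \int[Pr]_w (cst (K ^+ 2) w) <= _); last first.
  by rewrite Rintegral_prob_cst.
apply: le_Rintegral => //.
  by apply: (@bounded_integrable _ _ _ _ _ `|K ^+ 2|).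
by move=> w _; rewrite /= -expr2 -(real_normK (num_real (f _))) ler_pXn2r ?nnegrE.
Qed.

End weak_law.

(** Markov's inequality for the square of the centred sum.  The exceptional
    event is exhibited, so that it can be united with the enclosures of events
    that are not measurable. *)
Lemma weak_law_of_large_numbers (R : realType) (d : nat) (dO : measure_display)
    (Omega : measurableType dO) (Pr : probability Omega R)
    (P : probability (obs R d) R) (W : nat -> {mfun Omega >-> obs R d})
    (f : obs R d -> R) (K eps delta : R) :
  iid_sample Pr P W -> measurable_fun setT f -> (forall x, `|f x| <= K) ->
  0 < eps -> 0 < delta ->
  \forall n \near \oo, exists B : set Omega,
    [/\ measurable B, (Pr B <= delta%:E)%E & forall w, ~ B w ->
    `|n%:R^-1 * (\sum_(i < n) f (W i w)) - \int[P]_x f x| <= eps].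
Proof.
move=> W_iid mf fK eps0 delta0.
pose m := \int[P]_x f x; pose D x := f x - m; pose K' := K + `|m|.
have mD : measurable_fun setT D by apply: measurable_funB.
have DK x : `|D x| <= K' by rewrite (le_trans (ler_normB _ _))// lerD2r.
have D0 : \int[P]_x D x = 0.
  rewrite RintegralB//; first by rewrite Rintegral_prob_cst subrr.
    exact: bounded_integrable fK.
  exact: (@bounded_integrable _ _ _ _ (cst m) `|m|).
near=> n.
have n0 : (0 < n)%N by near: n; exact: nbhs_infty_gt.
have n0' : n%:R != 0 :> R by rewrite pnatr_eq0 -lt0n.
pose S w := \sum_(i < n) D (W i w).
have mS : measurable_fun setT S.
  by apply: measurable_sum => i; exact: measurableT_comp.
have SE w : n%:R^-1 * (\sum_(i < n) f (W i w)) - m = n%:R^-1 * S w.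
  by rewrite /S sumrB sumr_const card_ord mulrBr -[m *+ n]mulr_natl mulKf.
pose B := [set w | n%:R * eps < `|S w|].
have mB : measurable B.
  have -> : B = ~` [set w | `|S w| <= n%:R * eps].
    by apply/seteqP; split => w /=; rewrite /B/= ltNge => /negP.
  apply: measurableC; rewrite -[X in measurable X]setTI.
  by apply: measurable_fun_le => //; exact: measurableT_comp.
exists B; split => //; last first.
  move=> w /negP; rewrite -leNgt => Sw; rewrite SE normrM normfV normr_nat.
  by rewrite mulrC ler_pdivrMr ?ltr0n// mulrC.
have SK w : `|S w| <= n%:R * K'.
  rewrite (le_trans (ler_norm_sum _ _ _))// -[X in X%:R]card_ord -sum1_card natr_sum.
  by rewrite mulr_suml ler_sum// => i _; rewrite mul1r.
have markov : (n%:R * eps) ^+ 2 * fine (Pr B) <= n%:R * K' ^+ 2.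
  apply: le_trans (iid_second_moment W_iid mD DK n D0).
  have -> : (n%:R * eps) ^+ 2 * fine (Pr B) = \int[Pr]_w ((n%:R * eps) ^+ 2 * \1_B w).
    rewrite RintegralZl//; first by rewrite /Rintegral integral_indic// setIT.
    apply: (@bounded_integrable _ _ _ _ _ 1) => [|w]; first exact: measurable_indic.
    by rewrite indicE; case: (_ \in _); rewrite ?normr1 ?normr0.
  apply: le_Rintegral => //.
  - apply: (@bounded_integrable _ _ _ _ _ ((n%:R * eps) ^+ 2)) => [|w].
      by apply: measurable_funM => //; exact: measurable_indic.
    rewrite normrM [X in X * _]ger0_norm ?sqr_ge0// ler_piMr ?sqr_ge0// indicE.
    by case: (_ \in _); rewrite ?normr1 ?normr0.
  - apply: (@bounded_integrable _ _ _ _ _ ((n%:R * K') ^+ 2)) => [|w].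
      exact: measurable_funX.
    by rewrite normrX ler_pXn2r ?nnegrE// (le_trans _ (SK w)).
  - move=> w _; rewrite indicE; case: (boolP (w \in B)) => [|_]; last first.
      by rewrite mulr0 sqr_ge0.
    rewrite inE /B/= mulr1 -[leRHS]real_normK ?num_real// => /ltW Sw.
    by rewrite ler_pXn2r ?nnegrE// mulr_ge0// ltW.
have nK : K' ^+ 2 / (eps ^+ 2 * delta) <= n%:R by near: n; exact: nbhs_infty_ger.
rewrite -(fineK (fin_num_measure Pr _ mB)) lee_fin.
rewrite ler_pdivrMr ?mulr_gt0 ?exprn_gt0// in nK.
rewrite -(ler_pM2l (_ : 0 < (n%:R * eps) ^+ 2)) ?exprn_gt0 ?mulr_gt0 ?ltr0n//.
rewrite (le_trans markov)//.
have -> : (n%:R * eps) ^+ 2 * delta = n%:R * (n%:R * (eps ^+ 2 * delta)) by ring.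
by rewrite ler_wpM2l.
Unshelve. all: by end_near. Qed.

(** * Events of small probability *)

(** The outer probability of the bad event is an infimum over countable
    measurable covers; the union of a nearly optimal cover is the exceptional
    event. *)
Lemma bigO_prob_eventually (R : realType) (dO : measure_display)
    (Omega : measurableType dO) (Pr : probability Omega R)
    (X : nat -> Omega -> \bar R) (a : nat -> R) (e delta : R) :
  bigO_prob Pr X a -> a n @[n --> \oo] --> (0 : R) -> 0 < e -> 0 < delta ->
  \forall n \near \oo, exists B : set Omega,
    [/\ measurable B, (Pr B <= delta%:E)%E & forall w, ~ B w -> (X n w <= e%:E)%E].
Proof.
move=> [a0 XO] acvg e0 delta0.
have [M M0 XM] := XO _ delta0.
near=> n.
have n0 : (0 < n)%N by near: n; exact: nbhs_infty_gt.
have aM : `|a n| <= e / M.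
  near: n; move/cvgrPdist_le: acvg => /(_ (e / M)); rewrite divr_gt0// => /(_ isT).
  by apply: filterS => n; rewrite sub0r normrN.
have : (mu_ext Pr [set w | M%:E < `|X n w * (a n)^-1%:E|] < delta%:E)%E.
  by apply: le_lt_trans XM; apply: ereal_sup_ubound; exists n.
move=> /ereal_inf_lt[_ [A [mA XA] <-] Adelta].
exists (\bigcup_k A k); split.
- exact: bigcup_measurable.
- rewrite (le_trans _ (ltW Adelta))//.
  by apply: measure_sigma_subadditive => //; exact: bigcup_measurable.
- move=> w Aw; have /negP : ~ (M%:E < `|X n w * (a n)^-1%:E|)%E.
    by move=> /XA.
  rewrite -leNgt; have := a0 n n0; case: (X n w) => [r| |] an0.
  + rewrite -EFinM abse_EFin !lee_fin normrM normfV ler_pdivrMr ?normr_gt0//.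
    move=> /(le_trans (ler_norm _))/le_trans; apply.
    by rewrite mulrC -ler_pdivlMr.
  + rewrite mulyr; have [an|an|an] := sgrP (a n)^-1; rewrite ?mul1e ?mulN1e//.
    by move: an0; rewrite -invr_eq0 an eqxx.
  + by rewrite leNye.
Unshelve. all: by end_near. Qed.

Lemma limn_einf_eq1 (R : realType) (u : nat -> \bar R) :
  (forall n, 0 <= u n <= 1)%E ->
  (forall delta : R, 0 < delta -> \forall n \near \oo, (1 - delta%:E <= u n)%E) ->
  limn_einf u = 1%E.
Proof.
move=> u01 u1.
have uE n : u n = (fine (u n))%:E.
  by have /andP[u0 un1] := u01 n; rewrite fineK// ge0_fin_numE// (le_lt_trans un1)// ltry.
suff /cvg_limn_einf_sup[] : u n @[n --> \oo] --> 1%E by [].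
rewrite (funext uE); apply: cvg_EFin; first by apply: nearW.
apply/cvgrPdist_le => e e0; have := u1 _ e0; apply: filterS => n.
have /andP[_] := u01 n; rewrite uE -EFinB !lee_fin /= => ? ?.
by rewrite ger0_norm; lra.
Qed.

(** * Power of the test *)

Lemma ler_norm_mulB (R : realDomainType) (a b a' b' L e e' : R) :
  `|a| <= L -> `|b'| <= L -> `|a - a'| <= e -> `|b - b'| <= e' ->
  `|a' * b' - a * b| <= L * (e + e').
Proof.
move=> aL bL ae be; have -> : a' * b' - a * b = - ((a - a') * b' + a * (b - b')).
  by ring.
rewrite normrN (le_trans (ler_normD _ _))// !normrM mulrDr lerD//.
  by rewrite mulrC ler_pM.
by rewrite ler_pM.
Qed.

Lemma measurable_obs_cube (R : realType) d : measurable (@obs_cube R d).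
Proof.
apply: measurableX; first exact: measurableX.
have -> : @cube R d = \bigcap_(i in [set: 'I_d])
    ((fun z : d.-tuple R => tnth z i) @^-1` `[0, 1]%classic).
  by apply/seteqP; split => z /= zi i => [_|]; exact: zi.
apply: fin_bigcap_measurable => // i _; rewrite -[X in measurable X]setTI.
exact: measurable_tnth.
Qed.

Lemma iid_sample_cube (R : realType) d (dO : measure_display)
    (Omega : measurableType dO) (Pr : probability Omega R)
    (P : probability (obs R d) R) (W : nat -> {mfun Omega >-> obs R d}) :
  iid_sample Pr P W -> P (@obs_cube R d) = 1%E ->
  exists B : set Omega, [/\ measurable B, Pr B = 0 &
    forall w, ~ B w -> forall i, obs_cube (W i w)].
Proof.
move=> W_iid Pcube; have mC := @measurable_obs_cube R d.
have mWC i : measurable (W i @^-1` (~` @obs_cube R d)).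
  by rewrite -[X in measurable X]setTI; apply: measurable_funPT => //; exact: measurableC.
exists (\bigcup_i (W i @^-1` (~` @obs_cube R d))); split.
- exact: bigcup_measurable.
- apply/measure_negligible; first exact: bigcup_measurable.
  apply: negligible_bigcup => i; apply/negligibleP => //.
  apply: etrans (iid_law W_iid i (measurableC mC)) _.
  by rewrite probability_setC// Pcube subee.
- by move=> w Bw i; apply: contrapT => Ci; apply: Bw; exists i.
Qed.

Lemma sup_norm_on_le (R : realType) d (S : d.-tuple R -> set R)
    (f : R -> d.-tuple R -> R) (e : R) : (sup_norm_on S f <= e%:E)%E ->
  forall z t, cube z -> S z t -> `|f t z| <= e.
Proof.
move=> fe z t cz St; rewrite -lee_fin; apply: le_trans fe.
by apply: ereal_sup_ubound; exists z, t.
Qed.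

Section power.
Context (R : realType) (d q : nat) (phi : 'I_q -> R -> R).
Hypothesis phi_score : score_system phi.
Variable L : R.
Hypothesis L_ge0 : 0 <= L.
Hypothesis phi_lip : forall j u v, u \in `[0, 1] -> v \in `[0, 1] ->
  `|phi j u - phi j v| <= L * `|u - v|.

Lemma rho_hat_near_oracle (kX kY : R.-pker d.-tuple R ~> R) (FX FY : cdf_rule R d)
    (dO : measure_display) (Omega : measurableType dO) (W : nat -> Omega -> obs R d)
    n (w : Omega) (e : R) (k l : 'I_q) :
  (forall z, cube z -> kX z `[0, 1]%classic = 1%E) ->
  (forall z, cube z -> continuous (cond_cdf kX ^~ z)) ->
  (forall z, cube z -> kY z `[0, 1]%classic = 1%E) ->
  (forall z, cube z -> continuous (cond_cdf kY ^~ z)) ->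
  cdf_estimator FX -> cdf_estimator FY -> (0 < n)%N ->
  (forall i, obs_cube (W i w)) ->
  (sup_norm_in phi kX (fun t z =>
     cond_cdf kX t z - FX n (sampleXZ W n w) t z)%R <= e%:E)%E ->
  (sup_norm_in phi kY (fun t z =>
     cond_cdf kY t z - FY n (sampleYZ W n w) t z)%R <= e%:E)%E ->
  `|rho_hat phi FX FY W n w k l - n%:R^-1 * \sum_(i < n)
     (phi k (cond_cdf kX (coordX (W i w)) (coordZ (W i w))) *
      phi l (cond_cdf kY (coordY (W i w)) (coordZ (W i w))))| <= 2 * L ^+ 2 * e.
Proof.
move=> kX1 kXc kY1 kYc FX_est FY_est n0 Wcube /sup_norm_on_le Xe /sup_norm_on_le Ye.
have Xs i : (tnth (sampleXZ W n w) i).1 \in `[0, 1] /\ cube (tnth (sampleXZ W n w) i).2.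
  by rewrite tnth_mktuple; have [[]] := Wcube i.
have Ys i : (tnth (sampleYZ W n w) i).1 \in `[0, 1] /\ cube (tnth (sampleYZ W n w) i).2.
  by rewrite tnth_mktuple; have [[]] := Wcube i.
rewrite mxE -mulrBr -sumrB normrM normfV normr_nat ler_pdivrMl ?ltr0n//.
rewrite (le_trans (ler_norm_sum _ _ _))//.
rewrite -[X in _ <= X%:R * _]card_ord -sum1_card natr_sum mulr_suml ler_sum// => i _.
have [[Xi Yi] Zi] := Wcube i.
have [GX01 _ GXh _ _] := FX_est n (sampleXZ W n w) n0 Xs _ Zi.
have [GY01 _ GYh _ _] := FY_est n (sampleYZ W n w) n0 Ys _ Zi.
rewrite mul1r (_ : 2 * L ^+ 2 * e = L * (L * e + L * e)); last by ring.
apply: ler_norm_mulB.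
- exact: (score_le phi_score L_ge0 phi_lip _ (cond_cdf01 _ _ _)).
- exact: (score_le phi_score L_ge0 phi_lip _ (GY01 _ Yi)).
- by apply: (score_plugin (kX1 _ Zi) (kXc _ Zi) phi_score L_ge0 phi_lip
    (G := fun t => FX n (sampleXZ W n w) t (coordZ (W i w)))) => // t; exact: Xe.
- by apply: (score_plugin (kY1 _ Zi) (kYc _ Zi) phi_score L_ge0 phi_lip
    (G := fun t => FY n (sampleYZ W n w) t (coordZ (W i w)))) => // t; exact: Ye.
Qed.

Lemma measurable_score_cond_cdf (k : R.-pker d.-tuple R ~> R) V j :
  measurable_fun setT V ->
  measurable_fun setT (fun w : obs R d => phi j (cond_cdf k (V w) (coordZ w))).
Proof.
move=> mV; have [psi [psic psiE]] := score_extension phi_score.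
apply: (@eq_measurable_fun _ _ _ _ _ (fun w => psi j (cond_cdf k (V w) (coordZ w)))).
  by move=> w _; rewrite psiE// cond_cdf01.
apply: (measurableT_comp (continuous_measurable_fun (psic j))).
exact: measurable_cond_cdf.
Qed.

End power.

Theorem corollary19 (R : realType) (d q : nat) (q_gt0 : (0 < q)%N)
  (phi : 'I_q -> R -> R) (phi_score : score_system phi)
  (dO : measure_display) (Omega : measurableType dO)
  (W : nat -> {mfun Omega >-> obs R d})
  (P0 : set (probability (obs R d) R)) (P0_ac : P0 `<=` @ac_laws R d)
  (kX kY : probability (obs R d) R -> R.-pker d.-tuple R ~> R)
  (kX_law : forall P, P0 P -> continuous_cond_law (@coordX R d) P (kX P))
  (kY_law : forall P, P0 P -> continuous_cond_law (@coordY R d) P (kY P))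
  (Pr : probability (obs R d) R -> probability Omega R)
  (W_iid : forall P, P0 P -> iid_sample (Pr P) P W)
  (FX FY : cdf_rule R d)
  (FX_est : cdf_estimator FX) (FY_est : cdf_estimator FY)
  (rates : forall P, P0 P ->
    exists (g h : nat -> R) (xi xi' : R -> d.-tuple R -> R),
    [/\ (g n @[n --> \oo] --> (0 : R)) /\ (h n @[n --> \oo] --> (0 : R)),
        bigO_prob (Pr P) (fun n w => sup_norm_in phi (kX P) (fun t z =>
          cond_cdf (kX P) t z - FX n (sampleXZ W n w) t z)) g,
        bigO_prob (Pr P) (fun n w => sup_norm_in phi (kY P) (fun t z =>
          cond_cdf (kY P) t z - FY n (sampleYZ W n w) t z)) h,
        bigO_prob (Pr P) (fun n w => sup_norm_out phi (kX P) (fun t z =>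
          xi t z - FX n (sampleXZ W n w) t z)) g &
        bigO_prob (Pr P) (fun n w => sup_norm_out phi (kY P) (fun t z =>
          xi' t z - FY n (sampleYZ W n w) t z)) h])
  (A0 : set (probability (obs R d) R))
  (A0_def : A0 = [set P | (P0 `\` @ci_laws R d) P /\
     exists k l : 'I_q, rho phi P (kX P) (kY P) k l != 0])
  (alpha : R) (alpha01 : 0 < alpha < 1)
  (P : probability (obs R d) R) (AP : A0 P) :
  limn_einf (fun n => 'E_(Pr P)[test_Psi phi FX FY W alpha n])%E = 1%E.

  (* your proof *)

Proof.
have PP : P0 P /\ exists k l, rho phi P (kX P) (kY P) k l != 0.
  by move: AP; rewrite A0_def => -[[]].
have {PP} [P0P [k [l rho_neq0]]] := PP.
have [_ kX1 kXc] := kX_law _ P0P.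
have [_ kY1 kYc] := kY_law _ P0P.
have [Pcube _] := P0_ac _ P0P.
have [g [h [xi [xi' [[gcvg hcvg] XO YO _ _]]]]] := rates _ P0P.
have [L L0 phi_lip] := score_lipschitz phi_score.
have L_ge0 := ltW L0.
pose f (w : obs R d) := phi k (cond_cdf (kX P) (coordX w) (coordZ w)) *
  phi l (cond_cdf (kY P) (coordY w) (coordZ w)).
have mf : measurable_fun setT f.
  apply: measurable_funM; apply: (measurable_score_cond_cdf phi_score).
  - exact: (measurableT_comp measurable_fst measurable_fst).
  - exact: (measurableT_comp measurable_snd measurable_fst).
have fL w : `|f w| <= L * L.
  by rewrite normrM ler_pM// (score_le phi_score L_ge0 phi_lip _ (cond_cdf01 _ _ _)).
have rhoE : rho phi P (kX P) (kY P) k l = \int[P]_w f w.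
  by rewrite mxE unlock.
set r := `|\int[P]_w f w|.
have r0 : 0 < r by rewrite normr_gt0 -rhoE.
have [K K0 TK] := frobenius_conj_lb (invsqrt_gram_unit phi_score).
set c := chi2_quantile (q ^ 2) (1 - alpha).
have [C [mC C0 Wcube]] := iid_sample_cube (W_iid _ P0P) Pcube.
(* A measurable event inside the rejection region bounds the power. *)
have E_mono n (B : set Omega) : measurable B ->
    (forall w, B w -> n%:R^-1 * c < T_stat phi FX FY W n w) ->
    (Pr P B <= 'E_(Pr P)[test_Psi phi FX FY W alpha n])%E.
  move=> mB BT; rewrite -expectation_indic// unlock.
  apply: le_integral_nonmeasurable => w; rewrite lee_fin// /test_Psi !indicE.
  case: (boolP (w \in B)) => // /set_mem /BT Tw.
  by rewrite mem_set.
apply: limn_einf_eq1 => [n|delta delta0].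
  apply/andP; split.
    by rewrite unlock integral_ge0// => w _; rewrite lee_fin.
  rewrite -[leRHS](expectation_cst (Pr P) 1) unlock.
  apply: le_integral_nonmeasurable => w; rewrite lee_fin// /test_Psi indicE.
  by case: (_ \in _).
have d3 : 0 < delta / 3 by rewrite divr_gt0.
(* With this accuracy the plug-in error [2 L^2 e] is [r / 4]; the weak law
   contributes another [r / 4], which leaves [r / 2] for [rho_hat]. *)
pose e := r / (8 * L ^+ 2).
have e0 : 0 < e by rewrite divr_gt0// mulr_gt0// exprn_gt0.
have r4 : 0 < r / 4 by rewrite divr_gt0.
near=> n.
have n0 : (0 < n)%N by near: n; exact: nbhs_infty_gt.
have [B1 [mB1 PB1 B1P]] : exists B : set Omega, [/\ measurable B,
    (Pr P B <= (delta / 3)%:E)%E & forall w, ~ B w ->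
    (sup_norm_in phi (kX P) (fun t z =>
       cond_cdf (kX P) t z - FX n (sampleXZ W n w) t z)%R <= e%:E)%E].
  by near: n; exact: (bigO_prob_eventually XO gcvg e0 d3).
have [B2 [mB2 PB2 B2P]] : exists B : set Omega, [/\ measurable B,
    (Pr P B <= (delta / 3)%:E)%E & forall w, ~ B w ->
    (sup_norm_in phi (kY P) (fun t z =>
       cond_cdf (kY P) t z - FY n (sampleYZ W n w) t z)%R <= e%:E)%E].
  by near: n; exact: (bigO_prob_eventually YO hcvg e0 d3).
have [B3 [mB3 PB3 B3P]] : exists B : set Omega, [/\ measurable B,
    (Pr P B <= (delta / 3)%:E)%E & forall w, ~ B w ->
    `|n%:R^-1 * (\sum_(i < n) f (W i w)) - \int[P]_x f x| <= r / 4].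
  by near: n; exact: (weak_law_of_large_numbers (W_iid _ P0P) mf fL r4 d3).
have cn : c / (r ^+ 2 / 4 / K) < n%:R by near: n; exact: nbhs_infty_gtr.
pose B := C `|` (B1 `|` (B2 `|` B3)).
have mB : measurable B by do !apply: measurableU.
have PB : (Pr P B <= delta%:E)%E.
  have U2 (A A' : set Omega) : measurable A -> measurable A' ->
    (Pr P (A `|` A') <= Pr P A + Pr P A')%E by exact: measureU2.
  apply: (le_trans (U2 _ _ mC _)); first by do !apply: measurableU.
  rewrite C0 add0e; apply: (le_trans (U2 _ _ mB1 (measurableU _ _ mB2 mB3))).
  apply: (le_trans (leeD PB1 (le_trans (U2 _ _ mB2 mB3) (leeD PB2 PB3)))).
  by rewrite -!EFinD lee_fin; lra.
apply: (@le_trans _ _ (Pr P (~` B))).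
  by rewrite probability_setC// leeB.
apply: E_mono; first exact: measurableC.
move=> w Bw.
have Cw : ~ C w by move=> ?; apply: Bw; left.
have B1w : ~ B1 w by move=> ?; apply: Bw; right; left.
have B2w : ~ B2 w by move=> ?; apply: Bw; right; right; left.
have B3w : ~ B3 w by move=> ?; apply: Bw; right; right; right.
have := rho_hat_near_oracle phi_score L_ge0 phi_lip k l kX1 kXc kY1 kYc FX_est FY_est
  n0 (Wcube w Cw) (B1P w B1w) (B2P w B2w).
have -> : 2 * L ^+ 2 * e = r / 4 by rewrite /e; field; rewrite gt_eqF.
have := B3P w B3w; rewrite -/f.
set rb := _ * \sum_(i < n) _; set rh := rho_hat _ _ _ _ _ _ _ _ => rb_near rh_near.
have rhr : r / 2 <= `|rh|.
  have := le_trans (lerB_dist (\int[P]_x f x) rh) (ler_distD rb _ rh).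
  by rewrite -/r [`|_ - rb|]distrC [`|rb - rh|]distrC; lra.
have := TK (rho_hat phi FX FY W n w) k l; rewrite -/rh -/(T_stat phi FX FY W n w) => TKn.
have r2 : r ^+ 2 / 4 <= `|rh| ^+ 2.
  have -> : r ^+ 2 / 4 = (r / 2) ^+ 2 by field.
  by rewrite ler_pXn2r ?nnegrE// divr_ge0// ltW.
have : r ^+ 2 / 4 / K <= T_stat phi FX FY W n w.
  by rewrite ler_pdivrMr// (le_trans r2)// mulrC.
apply: lt_le_trans; rewrite ltr_pdivrMl ?ltr0n//.
by rewrite ltr_pdivrMr ?divr_gt0 ?exprn_gt0// in cn.
Unshelve. all: by end_near. Qed.
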